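(* Let $I\subseteq\mathbb{R}$ be an open interval and let $\alpha:I\to\mathbb{R}^3$ be a curve parametrized by arc length $s$, with curvature $\kappa=\kappa(s)>0$ and torsion $\tau=\tau(s)\neq 0$ for all $s\in I$, where $\kappa$ and $\tau$ are differentiable functions. Let $\lambda\neq 0$ be a real constant. Then $\alpha$ is a whirl curve with proportionality constant $\lambda$ if and only if for all $s\in I$ $$\tau=\frac{(1+\lambda^2)\left(\frac{\tau}{\kappa}\right)'}{\lambda\left(1+\lambda^2+\left(\frac{\tau}{\kappa}\right)^2\right)},$$ where $'$ denotes the derivative with respect to $s$.
   Context: For a unit speed curve $\alpha$ with positive curvature, $\{\mathbf{t},\mathbf{n},\mathbf{b}\}$ denotes its Frenet frame (tangent, normal, binormal), with Frenet equations $\mathbf{t}'=\kappa\mathbf{n}$, $\mathbf{n}'=-\kappa\mathbf{t}+\tau\mathbf{b}$, $\mathbf{b}'=-\tau\mathbf{n}$ (the curve is assumed smooth enough for the frame and these equations to exist). A whirl curve is a curve with curvature $\kappa>0$ and nowhere vanishing torsion $\tau$ such that there exist a constant unit vector $\mathbf{d}\in\mathbb{R}^3$ and a real constant $\lambda\neq0$ (the proportionality constant) with $\langle\mathbf{n}(s),\mathbf{d}\rangle=\lambda\langle\mathbf{t}(s),\mathbf{d}\rangle$ for all $s$. *)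

(* Defs.v *)
From HB Require Import structures.
From mathcomp Require Export all_boot all_order all_algebra.
From mathcomp Require Export all_classical all_reals all_analysis.
Export Order.TTheory GRing.Theory Num.Theory.
Export numFieldNormedType.Exports.

Set Implicit Arguments.
Unset Strict Implicit.
Unset Printing Implicit Defensive.

Local Open Scope ring_scope.

Section Euclidean.
Variable R : realType.
Implicit Types u v : 'rV[R]_3.

Definition dot u v : R := \sum_(i < 3) u 0 i * v 0 i.

(* The norm [`|u|] that the library puts on ['rV[R]_3] is the sup norm; it is
   used only through the topology (limits and derivatives), lengths being
   measured with [enorm]. *)
Definition enorm u : R := Num.sqrt (dot u u).

(* Component [i] is [u_(i+1) * v_(i+2) - u_(i+2) * v_(i+1)], with indices
   modulo 3. *)
Definition cross u v : 'rV[R]_3 :=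
  \row_(i < 3) (u 0 (ordS i) * v 0 (ordS (ordS i))
                - u 0 (ordS (ordS i)) * v 0 (ordS i)).

End Euclidean.

(* Curves are total functions [R -> 'rV[R]_3], of which only the values on the
   open interval [I] matter: the derivatives at points of [I] depend only on
   these values. *)
Section Frenet.
Variable R : realType.
Implicit Types (I : set R) (alpha : R -> 'rV[R]_3) (s lambda : R).

(* Three derivatives are what the Frenet frame of a curve of positive curvature
   needs in order to be differentiable. *)
Definition unit_speed_curve I alpha : Prop :=
  (forall k s, (k < 3)%N -> I s -> derivable (derive1n k alpha) s 1) /\
  (forall s, I s -> enorm (derive1 alpha s) = 1).

Definition tangent alpha : R -> 'rV[R]_3 := derive1 alpha.

Definition curvature alpha s : R := enorm (derive1 (tangent alpha) s).

Definition normal alpha s : 'rV[R]_3 :=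
  (curvature alpha s)^-1 *: (derive1 (tangent alpha) s).

Definition binormal alpha s : 'rV[R]_3 :=
  cross (tangent alpha s) (normal alpha s).

(* The sign convention is that of the Frenet equation [b' = - tau n]. *)
Definition torsion alpha s : R :=
  - dot (derive1 (binormal alpha) s) (normal alpha s).

Definition whirl_curve I alpha lambda : Prop :=
  [/\ lambda != 0,
      forall s, I s -> 0 < curvature alpha s,
      forall s, I s -> torsion alpha s != 0
    & exists d : 'rV[R]_3, enorm d = 1 /\
        forall s, I s ->
          dot (normal alpha s) d = lambda * dot (tangent alpha s) d].

End Frenet.

(* Main.v *)
(* Put [mu = tau / kappa]. Differentiating [<n, d> = lambda <t, d>] along the
   Frenet equations gives [mu <b, d> = (1 + lambda^2) <t, d>], and
   differentiating once more gives the equation multiplied by [<t, d>], which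
   cannot vanish since otherwise [d] would be orthogonal to the whole frame.
   Conversely, the equation says that
   [V = mu t + lambda mu n + (1 + lambda^2) b] satisfies [V' = r V] for a scalar
   function [r], so [V] has constant direction on the interval, and
   [d = V / |V|] is the required vector. *)
Require Import Defs.
From mathcomp Require Import ring.

Set Implicit Arguments.
Unset Strict Implicit.
Unset Printing Implicit Defensive.

Local Open Scope ring_scope.

(** * Derivatives at a point of an open interval *)

Lemma is_derive_mxP (R : realType) (m n : nat) (F : R -> 'M[R]_(m, n))
    (s : R) dF :
  is_derive s 1 F dF <-> forall i j, is_derive s 1 (fun x => F x i j) (dF i j).
Proof.
split=> [[Fs <-] i j | Fs].
  rewrite derive_mx // mxE.
  by apply: DeriveDef => //; have /derivable_mxP := Fs.
have dFs : derivable F s 1 by apply/derivable_mxP => i j; have [] := Fs i j.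
apply: DeriveDef => //; rewrite derive_mx //.
by apply/matrixP => i j; rewrite mxE; exact: derive_val.
Qed.

Lemma is_derive1M (R : realType) (f g : R -> R) (s : R) df dg :
  is_derive s 1 f df -> is_derive s 1 g dg ->
  is_derive s 1 (fun x => f x * g x) (df * g s + f s * dg).
Proof. by move=> fs gs; rewrite addrC [df * _]mulrC; exact: is_deriveM. Qed.

Lemma is_derive_derive1 (R : realType) (V : normedModType R) (f : R -> V)
    (s : R) df :
  is_derive s 1 f df -> derive1 f s = df.
Proof. by move=> fs; rewrite derive1E derive_val. Qed.

Lemma derivable_is_derive1 (R : realType) (V : normedModType R) (f : R -> V)
    (s : R) :
  derivable f s 1 -> is_derive s 1 f (derive1 f s).
Proof. by rewrite derive1E => /derivableP. Qed.

(** This is how an identity valid on [I] gets differentiated: as [I] is open, [f] and [g] agree near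
    [s]. *)
Lemma is_derive_open_unique (R : realType) (I : set R) (V : normedModType R)
    (f g : R -> V) (s : R) df dg :
  open I -> I s -> (forall x, I x -> f x = g x) ->
  is_derive s 1 f df -> is_derive s 1 g dg -> df = dg.
Proof.
move=> oI Is fg fs gs; rewrite -(is_derive_derive1 fs) -(is_derive_derive1 gs).
rewrite !derive1E; apply: near_eq_derive.
by apply: filterS (open_nbhs_nbhs (conj oI Is)) => x /fg.
Qed.

(** Mean value theorem on [[x, y]], a segment that [is_interval] keeps inside [I]. *)
Lemma is_derive0_interval_cst (R : realType) (I : set R) (f : R -> R) :
  is_interval I -> (forall s, I s -> is_derive s 1 f 0) ->
  forall x y, I x -> I y -> f x = f y.
Proof.
move=> itI f0 x y.
wlog xy : x y / x <= y.
  by move=> H Ix Iy; case: (leP x y) => [/H | /ltW /H/(_ Iy Ix)]; first exact.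
move=> Ix Iy.
have Ixy z : z \in `[x, y] -> I z by rewrite in_itv => /(itI x y Ix Iy).
apply/esym/eqP; rewrite -subr_eq0; apply/eqP.
have [|| c _ ->] := @MVT_segment R f (fun=> 0) x y xy; last by rewrite mul0r.
- by move=> z /subset_itv_oo_cc /Ixy /f0.
- by apply: derivable_within_continuous => z /Ixy /f0 [].
Qed.

(** Meant for a squared length [N] with logarithmic derivative [2 * r]: its power -1/2 then has
    logarithmic derivative [- r]. *)
Lemma is_derive_invsqrt (R : realType) (N : R -> R) (s r : R) :
  0 < N s -> is_derive s 1 N (2 * r * N s) ->
  is_derive s 1 (fun x => (Num.sqrt (N x))^-1) (- r * (Num.sqrt (N s))^-1).
Proof.
move=> N0 Ns; have q0 : Num.sqrt (N s) != 0 by rewrite gt_eqF // sqrtr_gt0.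
have qs := is_derive1_comp (is_derive1_sqrt N0) Ns.
apply: is_derive_eq (is_deriveV (f := Num.sqrt \o N) q0 qs) _ => /=.
rewrite -[X in 2 * r * X](sqr_sqrtr (ltW N0)) /GRing.scale /=.
by field.
Qed.

Section EuclideanCurves.
Variable R : realType.
Implicit Types u v w : 'rV[R]_3.

(** * Inner and cross products, orthonormal frames *)

Lemma ord3_ind (P : 'I_3 -> Prop) :
  P 0 -> P 1 -> P 2%:R -> forall i, P i.
Proof.
move=> P0 P1 P2 [[|[|[|i]]] ilt] //.
- by rewrite (_ : Ordinal ilt = 0) //; apply/val_inj.
- by rewrite (_ : Ordinal ilt = 1) //; apply/val_inj.
- by rewrite (_ : Ordinal ilt = 2%:R) //; apply/val_inj.
Qed.

Lemma dotE u v : dot u v = u 0 0 * v 0 0 + u 0 1 * v 0 1 + u 0 2%:R * v 0 2%:R.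
Proof.
rewrite /dot !big_ord_recl big_ord0 addr0 addrA.
by congr (_ * _ + _ * _ + _ * _); congr (_ _ _); apply/val_inj.
Qed.

Lemma crossE u v :
  (cross u v 0 0 = u 0 1 * v 0 2%:R - u 0 2%:R * v 0 1) *
  (cross u v 0 1 = u 0 2%:R * v 0 0 - u 0 0 * v 0 2%:R) *
  (cross u v 0 2%:R = u 0 0 * v 0 1 - u 0 1 * v 0 0).
Proof.
by do !split; rewrite mxE; congr (_ * _ - _ * _); congr (_ _ _); apply/val_inj.
Qed.

Lemma dotC u v : dot u v = dot v u.
Proof. by apply: eq_bigr => i _; rewrite mulrC. Qed.

Lemma dotDl u v w : dot (u + v) w = dot u w + dot v w.
Proof. by rewrite -big_split; apply: eq_bigr => i _; rewrite mxE mulrDl. Qed.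

Lemma dotZl a u v : dot (a *: u) v = a * dot u v.
Proof. by rewrite /dot mulr_sumr; apply: eq_bigr => i _; rewrite mxE mulrA. Qed.

Lemma dotDr u v w : dot u (v + w) = dot u v + dot u w.
Proof. by rewrite dotC dotDl !(dotC u). Qed.

Lemma dotZr a u v : dot u (a *: v) = a * dot u v.
Proof. by rewrite dotC dotZl dotC. Qed.

Lemma dotvv_ge0 u : 0 <= dot u u.
Proof. by apply: sumr_ge0 => i _; rewrite -expr2 sqr_ge0. Qed.

Lemma sqr_enorm u : enorm u ^+ 2 = dot u u.
Proof. by rewrite sqr_sqrtr // dotvv_ge0. Qed.

Lemma dot_cross u v : dot (cross u v) u = 0 /\ dot (cross u v) v = 0.
Proof. by split; rewrite dotE !crossE /=; ring. Qed.

Lemma cross_lagrange u v :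
  dot (cross u v) (cross u v) = dot u u * dot v v - dot u v ^+ 2.
Proof. by rewrite !dotE !crossE /=; ring. Qed.

Definition frame u v w : Prop :=
  [/\ dot u u = 1, dot v v = 1, dot w w = 1 &
  [/\ dot u v = 0, dot u w = 0 & dot v w = 0]].

Lemma frame_cross u v :
  dot u u = 1 -> dot v v = 1 -> dot u v = 0 -> frame u v (cross u v).
Proof.
move=> uu vv uv; have [wu wv] := dot_cross u v.
by split=> //; [rewrite cross_lagrange uu vv uv; ring | split; rewrite // dotC].
Qed.

(* For the matrix [M] with rows [u, v, w], [M *m M^T = 1] implies
   [M^T *m M = 1]. *)
Lemma frame_expand u v w x :
  frame u v w -> x = dot x u *: u + dot x v *: v + dot x w *: w.
Proof.
case=> uu vv ww [uv uw vw].
pose f (i : 'I_3) := [:: u; v; w]`_i.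
pose M := \matrix_(i < 3) f i.
have MM : M *m M^T = 1%:M.
  apply/matrixP => i j; rewrite !mxE.
  transitivity (dot (f i) (f j)).
    by apply: eq_bigr => k _; rewrite !mxE.
  move: i j; apply: ord3_ind; apply: ord3_ind; rewrite /f /=;
    by rewrite ?uu ?vv ?ww ?uv ?uw ?vw // dotC ?uv ?uw ?vw.
(* Write [x] as [(x *m M^T) *m M]: the entries of [x *m M^T] are the coefficients sought. *)
rewrite -[LHS]mulmx1 -(mulmx1C MM) mulmxA.
apply/rowP => j; rewrite !mxE.
rewrite !big_ord_recl big_ord0 addr0 addrA.
have E i : (x *m M^T) 0 i = dot x (f i).
  by rewrite mxE; apply: eq_bigr => k _; rewrite !mxE.
by rewrite !E !mxE.
Qed.

(** * Product rules for vector-valued functions *)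

Lemma is_derive_dot (F G : R -> 'rV[R]_3) (s : R) dF dG :
  is_derive s 1 F dF -> is_derive s 1 G dG ->
  is_derive s 1 (fun x => dot (F x) (G x)) (dot dF (G s) + dot (F s) dG).
Proof.
move=> /is_derive_mxP Fs /is_derive_mxP Gs.
have H (i : 'I_3) := is_derive1M (Fs 0 i) (Gs 0 i).
have := is_derive_sum H; rewrite big_split /=.
by congr is_derive; apply/funext => x; rewrite fct_sumE.
Qed.

Lemma is_derive_scale (f : R -> R) (G : R -> 'rV[R]_3) (s : R) df dG :
  is_derive s 1 f df -> is_derive s 1 G dG ->
  is_derive s 1 (fun x => f x *: G x) (df *: G s + f s *: dG).
Proof.
move=> fs /is_derive_mxP Gs; apply/is_derive_mxP => i j.
have := is_derive1M fs (Gs i j); rewrite !mxE.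
by congr is_derive; apply/funext => x; rewrite mxE.
Qed.

Lemma is_derive_cross (F G : R -> 'rV[R]_3) (s : R) dF dG :
  is_derive s 1 F dF -> is_derive s 1 G dG ->
  is_derive s 1 (fun x => cross (F x) (G x)) (cross dF (G s) + cross (F s) dG).
Proof.
move=> /is_derive_mxP Fs /is_derive_mxP Gs; apply/is_derive_mxP => i j.
rewrite [i]ord1.
pose k := ordS j; pose l := ordS k.
have crossj u v : cross u v 0 j = u 0 k * v 0 l - u 0 l * v 0 k by rewrite mxE.
have -> : (fun x => cross (F x) (G x) 0 j) =
    (fun x => F x 0 k * G x 0 l) - (fun x => F x 0 l * G x 0 k).
  by apply/funext => x; rewrite crossj.
apply: is_derive_eq (is_deriveB (is_derive1M (Fs 0 k) (Gs 0 l))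
  (is_derive1M (Fs 0 l) (Gs 0 k))) _.
by rewrite mxE !crossj; ring.
Qed.

Lemma is_derive_dotl (F : R -> 'rV[R]_3) (s : R) dF d :
  is_derive s 1 F dF -> is_derive s 1 (fun x => dot (F x) d) (dot dF d).
Proof.
move=> Fs; apply: is_derive_eq (is_derive_dot Fs (is_derive_cst d s 1)) _.
(* The zero derivative of the constant [d] is written [0 *: d], so that bilinearity disposes of
   it. *)
by rewrite -(scale0r d) dotZr mul0r addr0.
Qed.

(** * The Frenet equations *)

(* [k] and [w] stand for the curvature and the torsion. *)
Definition frenet (I : set R) (T N B : R -> 'rV[R]_3) (k w : R -> R) : Prop :=
  forall s, I s -> frame (T s) (N s) (B s) /\
    [/\ is_derive s 1 T (k s *: N s),
        is_derive s 1 N (- k s *: T s + w s *: B s) &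
        is_derive s 1 B (- w s *: N s)].

(** The product rule for a constant function; it is the source of the skew symmetry of the Frenet
    coefficients. *)
Lemma is_derive_dot_cst (I : set R) (F G : R -> 'rV[R]_3) (c s : R) dF dG :
  open I -> I s -> (forall x, I x -> dot (F x) (G x) = c) ->
  is_derive s 1 F dF -> is_derive s 1 G dG -> dot dF (G s) = - dot (F s) dG.
Proof.
move=> oI Is FG Fs Gs; apply/eqP; rewrite -addr_eq0; apply/eqP.
exact: (is_derive_open_unique oI Is FG (is_derive_dot Fs Gs)
  (is_derive_cst c s 1)).
Qed.

Lemma is_derive_dot_unit (I : set R) (F : R -> 'rV[R]_3) (s : R) dF :
  open I -> I s -> (forall x, I x -> dot (F x) (F x) = 1) ->
  is_derive s 1 F dF -> dot dF (F s) = 0.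
Proof.
move=> oI Is FF Fs; have := is_derive_dot_cst oI Is FF Fs Fs.
rewrite [dot (F s) _]dotC => /eqP.
by rewrite -addr_eq0 -mulr2n mulrn_eq0 => /eqP.
Qed.

(** Once [N] and [B] are known to be derivable, their derivatives are expanded in the frame, with
    coefficients found by differentiating the orthonormality relations. *)
Lemma frenet_equations (I : set R) (alpha : R -> 'rV[R]_3) :
  open I -> unit_speed_curve I alpha ->
  (forall s, I s -> 0 < curvature alpha s) ->
  (forall s, I s -> derivable (curvature alpha) s 1) ->
  frenet I (tangent alpha) (normal alpha) (binormal alpha)
    (curvature alpha) (torsion alpha).
Proof.
move=> oI [dalpha speed] k_gt0 dk.
set T := tangent alpha; set N := normal alpha; set B := binormal alpha.
set k := curvature alpha; set w := torsion alpha.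
have kN s : I s -> k s != 0 by move=> /k_gt0; rewrite lt0r => /andP[].
have TT s : I s -> dot (T s) (T s) = 1.
  by move=> Is; rewrite -sqr_enorm speed // expr1n.
have dT s : I s -> is_derive s 1 T (k s *: N s).
  move=> Is; rewrite /N /normal scalerA divff ?kN // scale1r.
  by apply: derivable_is_derive1; exact: (dalpha 1%N).
have TN s : I s -> dot (T s) (N s) = 0.
  move=> Is; have /eqP := is_derive_dot_unit oI Is TT (dT s Is).
  by rewrite dotZl mulf_eq0 (negPf (kN s Is)) dotC => /eqP.
have NN s : I s -> dot (N s) (N s) = 1.
  move=> Is; rewrite dotZl dotZr -sqr_enorm -/(curvature alpha s) -/k.
  by field; exact: kN.
have fr s : I s -> frame (T s) (N s) (B s).
  by move=> Is; apply: frame_cross; [exact: TT | exact: NN | exact: TN].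
have [TB NB BB] : [/\ forall s, I s -> dot (T s) (B s) = 0,
    forall s, I s -> dot (N s) (B s) = 0 &
    forall s, I s -> dot (B s) (B s) = 1].
  by split=> s /fr [? ? ? []].
(* As [N] is [T'] divided by the curvature, this uses the third derivative of [alpha] and the
   derivability of the curvature. *)
have dN s : I s -> is_derive s 1 N (derive1 N s).
  move=> Is; have ddT := derivable_is_derive1 (dalpha 2%N s isT Is).
  have kV := is_deriveV (kN s Is) (derivable_is_derive1 (dk s Is)).
  have H := is_derive_scale kV ddT.
  by apply: derivable_is_derive1; case: H.
have dB s : I s -> is_derive s 1 B (derive1 B s).
  move=> Is; apply: derivable_is_derive1.
  by have [] := is_derive_cross (dT s Is) (dN s Is).
move=> s Is; split; first exact: fr.
have TdN : dot (derive1 N s) (T s) = - k s.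
  rewrite dotC; have := is_derive_dot_cst oI Is TN (dT s Is) (dN s Is).
  by rewrite dotZl NN // mulr1 => ->; rewrite opprK.
have NdN := is_derive_dot_unit oI Is NN (dN s Is).
have BdB := is_derive_dot_unit oI Is BB (dB s Is).
(* The only coefficient that holds by definition of the torsion. *)
have NdB : dot (derive1 B s) (N s) = - w s by rewrite opprK.
have BdN : dot (derive1 N s) (B s) = w s.
  by rewrite (is_derive_dot_cst oI Is NB (dN s Is) (dB s Is)) dotC NdB opprK.
have TdB : dot (derive1 B s) (T s) = 0.
  have := is_derive_dot_cst oI Is TB (dT s Is) (dB s Is).
  by rewrite dotZl NB // mulr0 dotC => /eqP; rewrite eq_sym oppr_eq0 => /eqP.
split; first exact: dT.
- apply: is_derive_eq (dN s Is) _.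
  by rewrite [LHS](frame_expand _ (fr s Is)) TdN NdN BdN scale0r addr0.
- apply: is_derive_eq (dB s Is) _.
  by rewrite [LHS](frame_expand _ (fr s Is)) TdB NdB BdB !scale0r add0r addr0.
Qed.

(** * Necessity of the torsion equation *)

Lemma whirl_axis_torsion (I : set R) (T N B : R -> 'rV[R]_3)
    (k w : R -> R) (l s dmu : R) d :
  open I -> I s -> frenet I T N B k w -> (forall x, I x -> k x != 0) ->
  w s != 0 -> l != 0 -> enorm d = 1 ->
  (forall x, I x -> dot (N x) d = l * dot (T x) d) ->
  is_derive s 1 (fun x => w x / k x) dmu ->
  w s = (1 + l ^+ 2) * dmu / (l * (1 + l ^+ 2 + (w s / k s) ^+ 2)).
Proof.
move=> oI Is fr kN wN lN d1 Nd dmus.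
have dotT x : I x -> is_derive x 1 (fun x => dot (T x) d) (k x * dot (N x) d).
  by move=> /fr[_ [dT _ _]]; rewrite -dotZl; exact: is_derive_dotl.
have dotN x : I x -> is_derive x 1 (fun x => dot (N x) d)
    (- k x * dot (T x) d + w x * dot (B x) d).
  by move=> /fr[_ [_ dN _]]; rewrite -!dotZl -dotDl; exact: is_derive_dotl.
have dotB x : I x -> is_derive x 1 (fun x => dot (B x) d) (- w x * dot (N x) d).
  by move=> /fr[_ [_ _ dB]]; rewrite -dotZl; exact: is_derive_dotl.
(* First differentiation: [-k <t,d> + w <b,d> = l k <n,d> = l^2 k <t,d>], then division by [k]. *)
have Bd x : I x -> w x / k x * dot (B x) d = (1 + l ^+ 2) * dot (T x) d.
  move=> Ix.
  have := is_derive_open_unique oI Ix Nd (dotN x Ix)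
    (is_derive1M (is_derive_cst l x 1) (dotT x Ix)).
  rewrite /= mul0r add0r Nd // => H.
  apply: (mulfI (kN x Ix)); rewrite mulrA [k x * _]mulrC divfK ?kN //.
  by apply/eqP; rewrite -subr_eq0; move/eqP: H; rewrite -subr_eq0 => /eqP H;
    apply/eqP; rewrite -[RHS]H; ring.
(* Second differentiation, applied to [Bd]. *)
have := is_derive_open_unique oI Is Bd (is_derive1M dmus (dotB s Is))
  (is_derive1M (is_derive_cst (1 + l ^+ 2) s 1) (dotT s Is)).
have kNs := kN s Is; have Bds := Bd s Is.
have frs := (fr s Is).1.
rewrite /= mul0r add0r Nd // => H.
(* If [<t,d>] were 0, then so would be [<n,d>] by [Nd] and [<b,d>] by [Bds], as the torsion is
   nonzero; expanding one factor of [<d,d>] in the frame would give 0 instead of 1. *)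
have xN0 : dot (T s) d != 0.
  apply/negP => /eqP x0; move/eqP: Bds.
  rewrite x0 mulr0 !mulf_eq0 invr_eq0 (negPf wN) (negPf kNs) /= => /eqP z0.
  move: d1 => /(congr1 (fun x => x ^+ 2)); rewrite sqr_enorm expr1n.
  rewrite {1}(frame_expand d frs) !(dotC d) Nd // x0 z0 mulr0 !scale0r !addr0.
  by rewrite -(scale0r d) dotZl mul0r => /esym/eqP; rewrite oner_eq0.
set x := dot (T s) d in H Bds xN0; set z := dot (B s) d in H Bds.
have l2 : 0 < 1 + l ^+ 2 by rewrite ltr_wpDr ?sqr_ge0 // ltr01.
have DN : 1 + l ^+ 2 + (w s / k s) ^+ 2 != 0.
  by rewrite gt_eqF // ltr_wpDr // sqr_ge0.
apply: (mulIf (mulf_neq0 lN DN)); rewrite divfK ?mulf_neq0 //.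
apply: (mulIf xN0); apply/eqP; rewrite -subr_eq0; apply/eqP.
(* With [mu] opaque and [w s] replaced by [mu * k s], no division remains and [ring] can
   conclude. *)
set mu := w s / k s in H Bds DN *.
have wE : w s = mu * k s by rewrite divfK.
clearbody mu; rewrite wE in H *.
(* [H] is multiplied by [mu] to make [mu * z] appear, which [Bds] then trades for a multiple of
   [x]. *)
have E1 : dmu * (mu * z) = mu * ((1 + l ^+ 2) * (k s * (l * x)) +
   mu * (mu * k s) * (l * x)) by rewrite -H; ring.
rewrite Bds in E1.
have -> : mu * k s * (l * (1 + l ^+ 2 + mu ^+ 2)) * x - (1 + l ^+ 2) * dmu * x
  = - (dmu * ((1 + l ^+ 2) * x) - mu * ((1 + l ^+ 2) * (k s * (l * x)) +
   mu * (mu * k s) * (l * x))) by ring.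
by rewrite E1 subrr oppr0.
Qed.

(** * Sufficiency: construction of the axis *)

Lemma torsion_whirl_axis (I : set R) (T N B : R -> 'rV[R]_3)
    (k w : R -> R) (l : R) (dmu : R -> R) :
  is_interval I -> frenet I T N B k w -> (forall x, I x -> k x != 0) ->
  (forall x, I x -> w x != 0) -> l != 0 ->
  (forall x, I x -> is_derive x 1 (fun x => w x / k x) (dmu x)) ->
  (forall x, I x ->
    w x = (1 + l ^+ 2) * dmu x / (l * (1 + l ^+ 2 + (w x / k x) ^+ 2))) ->
  exists d : 'rV[R]_3, enorm d = 1 /\
    forall x, I x -> dot (N x) d = l * dot (T x) d.
Proof.
move=> itI fr kN wN lN dmus weq.
have l2 : 0 < 1 + l ^+ 2 by rewrite ltr_wpDr ?sqr_ge0 // ltr01.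
have l2N := lt0r_neq0 l2.
pose mu x := w x / k x.
(* [q] is [<V,V>] in factored form, so [W] is [V] normalized. The factor [r] is read off the
   binormal component of [V' = r V], namely [l mu w = r (1 + l^2)]. *)
pose q x := (1 + l ^+ 2) * (1 + l ^+ 2 + mu x ^+ 2).
pose V x := mu x *: T x + (l * mu x) *: N x + (1 + l ^+ 2) *: B x.
pose W x := (Num.sqrt (q x))^-1 *: V x.
pose r x := l * w x * mu x / (1 + l ^+ 2).
have q_gt0 x : 0 < q x by rewrite mulr_gt0 // ltr_wpDr // sqr_ge0.
(* The hypothesis solved for [mu']; it is what makes the tangent and normal components of [V' = r V]
   agree as well. *)
have dmuE x : I x -> dmu x = l * w x * (1 + l ^+ 2 + mu x ^+ 2) / (1 + l ^+ 2).
  move=> Ix; have DN : 1 + l ^+ 2 + mu x ^+ 2 != 0.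
    by rewrite gt_eqF // ltr_wpDr // sqr_ge0.
  rewrite [in RHS]weq // -/(mu x).
  by field; rewrite lN DN l2N.
have dV x : I x -> is_derive x 1 V (r x *: V x).
  move=> Ix; have [_ [dT dN dB]] := fr x Ix.
  have H := is_deriveD (is_deriveD (is_derive_scale (dmus x Ix) dT)
    (is_derive_scale (is_derive1M (is_derive_cst l x 1) (dmus x Ix)) dN))
    (is_derive_scale (is_derive_cst (1 + l ^+ 2) x 1) dB).
  apply: is_derive_eq H _.
  apply/rowP => j; rewrite !mxE /= -/(mu x) dmuE // /r.
  have wE : w x = mu x * k x by rewrite divfK ?kN.
  by rewrite !wE; field.
have dq x : I x -> is_derive x 1 q (2 * r x * q x).
  move=> Ix.
  have H := is_derive1M (is_derive_cst (1 + l ^+ 2) x 1)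
    (is_deriveD (is_derive_cst (1 + l ^+ 2) x 1)
      (is_derive1M (dmus x Ix) (dmus x Ix))).
  apply: is_derive_eq H _; rewrite /= -/(mu x) dmuE // /r /q.
  by field.
(* The factor [q^(-1/2)] contributes [- r] and [V] contributes [r]. *)
have dW x : I x -> is_derive x 1 W 0.
  move=> Ix; have H := is_derive_scale
    (is_derive_invsqrt (q_gt0 x) (dq x Ix)) (dV x Ix).
  apply: is_derive_eq H _.
  by rewrite scalerA -scalerDl mulNr mulrC addNr scale0r.
have Wcst x y : I x -> I y -> W x = W y.
  move=> Ix Iy; apply/rowP => j.
  apply: (is_derive0_interval_cst (f := fun x => W x 0 j) itI) Ix Iy => s Is.
  by have /is_derive_mxP/(_ 0 j) := dW s Is; rewrite mxE.
have dotW x : I x -> [/\ dot (W x) (W x) = 1,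
   dot (T x) (W x) = (Num.sqrt (q x))^-1 * mu x &
   dot (N x) (W x) = (Num.sqrt (q x))^-1 * (l * mu x)].
  move=> /fr[[TT NN BB [TN TB NB]] _].
  have TV : dot (T x) (V x) = mu x.
    by rewrite /V !dotDr !dotZr TT TN TB; ring.
  have NV : dot (N x) (V x) = l * mu x.
    by rewrite /V !dotDr !dotZr NN dotC TN NB; ring.
  have BV : dot (B x) (V x) = 1 + l ^+ 2.
    by rewrite /V !dotDr !dotZr BB !(dotC (B x)) TB NB; ring.
  rewrite /W !dotZl !dotZr TV NV; split=> //.
  rewrite {1}/V !dotDl !dotZl TV NV BV.
  rewrite mulrA -invfM -expr2 sqr_sqrtr ?ltW // mulrC.
  by apply: (canLR (mulfK (lt0r_neq0 (q_gt0 x)))); rewrite /q; ring.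
(* [I] may be empty; any unit vector then serves, here the first basis vector. *)
have [[s Is]|I0] := pselect (exists s, I s); last first.
  exists (delta_mx 0 0); split; last by move=> s Is; case: I0; exists s.
  by rewrite /enorm dotE !mxE /= !mulr0 !addr0 mulr1 sqrtr1.
exists (W s); split.
  by rewrite /enorm; have [-> _ _] := dotW s Is; rewrite sqrtr1.
move=> x Ix; rewrite (Wcst s x) //; have [_ -> ->] := dotW x Ix.
by ring.
Qed.
End EuclideanCurves.

Theorem theorem2p2 (R : realType) (I : set R) (alpha : R -> 'rV[R]_3)
    (lambda : R)
    (I_open : open I) (I_interval : is_interval I)
    (alpha_unit_speed : unit_speed_curve I alpha)
    (curvature_gt0 : forall s : R, I s -> 0 < curvature alpha s)
    (torsion_neq0 : forall s : R, I s -> torsion alpha s != 0)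
    (curvature_derivable : forall s : R, I s -> derivable (curvature alpha) s 1)
    (torsion_derivable : forall s : R, I s -> derivable (torsion alpha) s 1)
    (lambda_neq0 : lambda != 0) :
  whirl_curve I alpha lambda <->
  forall s : R, I s ->
    torsion alpha s =
      (1 + lambda ^+ 2)
      * derive1 (fun x : R => torsion alpha x / curvature alpha x) s
      / (lambda *
         (1 + lambda ^+ 2 + (torsion alpha s / curvature alpha s) ^+ 2)).
Proof.
have frA := frenet_equations I_open alpha_unit_speed curvature_gt0
  curvature_derivable.
have kN s : I s -> curvature alpha s != 0.
  by move=> /curvature_gt0; rewrite lt0r => /andP[].
have dmu s (Is : I s) : is_derive s 1
    (fun x => torsion alpha x / curvature alpha x)
    (derive1 (fun x => torsion alpha x / curvature alpha x) s).
  apply: derivable_is_derive1; apply: derivableM.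
    exact: torsion_derivable.
  by apply: derivableV; [exact: kN | exact: curvature_derivable].
split=> [[_ _ _ [d [d1 Nd]]] s Is | weq].
  apply: (whirl_axis_torsion I_open Is frA kN) d1 Nd (dmu s Is) => //.
  exact: torsion_neq0.
split=> //; exact: (torsion_whirl_axis I_interval frA kN).
Qed.
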